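(* Let $S$ be a monoid and let $A$ be a quasi-injective strongly Hopfian right $S$-act whose endomorphism monoid $\mathrm{End}_S(A)$ is commutative. Then $A$ is strongly co-Hopfian.
   Context: $S$ is a monoid. A (right) $S$-act is a non-empty set $A$ with a map $A\times S\to A$, $(a,s)\mapsto as$, satisfying $a1=a$ and $a(st)=(as)t$ for all $a\in A$, $s,t\in S$. An $S$-homomorphism (or $S$-act map) $f:A\to B$ is a map with $f(as)=f(a)s$ for all $a\in A$, $s\in S$; $\mathrm{End}_S(A)$ is the monoid of $S$-homomorphisms $A\to A$ (endomorphisms) under composition. An $S$-act $A$ is quasi-injective if for every $S$-act $B$, every injective $S$-act map $g:B\to A$ and every $S$-act map $f:B\to A$, there exists an endomorphism $h$ of $A$ such that $f=hg$. For $f\in \mathrm{End}_S(A)$ put $\mathcal{K}_f=\{(a_1,a_2)\in A\times A\mid f(a_1)=f(a_2)\}$ and $\mathcal{I}_f=(\mathrm{im} f\times \mathrm{im} f)\cup\Delta_A$, where $\Delta_A=\{(a,a)\mid a\in A\}$. The $S$-act $A$ is strongly Hopfian if for every $f\in\mathrm{End}_S(A)$ the ascending chain $\mathcal{K}_f\subseteq \mathcal{K}_{f^2}\subseteq\cdots$ stabilizes, i.e. there is a positive integer $n$ with $\mathcal{K}_{f^m}=\mathcal{K}_{f^n}$ for all $m\ge n$. It is strongly co-Hopfian if for every $f\in\mathrm{End}_S(A)$ the descending chain $\mathcal{I}_f\supseteq \mathcal{I}_{f^2}\supseteq\cdots$ stabilizes, i.e. there is a positive integer $n$ with $\mathcal{I}_{f^m}=\mathcal{I}_{f^n}$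 for all $m\ge n$. *)

(* Defs.v *)
From HB Require Import structures.
From mathcomp Require Import all_boot boolp classical_sets functions.

Set Implicit Arguments.
Unset Strict Implicit.
Unset Printing Implicit Defensive.

Import Algebra.
Local Open Scope group_scope.
Local Open Scope classical_set_scope.

HB.mixin Record isAct (S : monoidType) (A : Type) := {
  act : A -> S -> A;
  act_nonempty : inhabited A;
  act1 : forall a : A, act a 1 = a;
  actM : forall (a : A) (s t : S), act a (s * t) = act (act a s) t
}.

#[short(type="actType")]
HB.structure Definition Act (S : monoidType) := {A of isAct S A}.

HB.mixin Record isActHom (S : monoidType) (A B : actType S) (f : A -> B) := {
  act_homE : forall (a : A) (s : S), f (act a s) = act (f a) s
}.

HB.structure Definition ActHom (S : monoidType) (A B : actType S) :=
  {f of isActHom S A B f}.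

Notation "{ 'acthom' A -> B }" := (ActHom.type A%type B%type)
  (at level 0, A at level 98, B at level 99,
   format "{ 'acthom'  A  ->  B }") : type_scope.

Section EndMonoid.
Variable S : monoidType.

Lemma acthom_eqP (A B : actType S) (f g : {acthom A -> B}) :
  f = g <-> f =1 g.
Proof.
split=> [-> //|]; case: f g => f [[Hf]] [g [[Hg]]] /= /funext fg.
by move: Hf Hg; rewrite fg => Hf Hg; rewrite (Prop_irrelevance Hf Hg).
Qed.

HB.instance Definition _ (A B : actType S) := gen_eqMixin {acthom A -> B}.
HB.instance Definition _ (A B : actType S) := gen_choiceMixin {acthom A -> B}.

Fact acthom_comp_subproof (A B C : actType S) (f : {acthom B -> C})
    (g : {acthom A -> B}) (a : A) (s : S) :
  (f \o g) (act a s) = act ((f \o g) a) s.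
Proof. by rewrite /= !act_homE. Qed.

HB.instance Definition _ (A B C : actType S) (f : {acthom B -> C})
    (g : {acthom A -> B}) :=
  isActHom.Build S A C (f \o g) (acthom_comp_subproof f g).

Variable A : actType S.

Fact acthom_id_subproof (a : A) (s : S) :
  idfun (act a s) = act (idfun a) s.
Proof. by []. Qed.

HB.instance Definition _ := isActHom.Build S A A idfun acthom_id_subproof.

Definition acthom_one : {acthom A -> A} := @idfun A.
Definition acthom_mul (f g : {acthom A -> A}) : {acthom A -> A} := f \o g.

Fact acthom_mulA : associative acthom_mul.
Proof. by move=> f g h; apply/acthom_eqP. Qed.
Fact acthom_mul1 : left_id acthom_one acthom_mul.
Proof. by move=> f; apply/acthom_eqP. Qed.
Fact acthom_mulr1 : right_id acthom_one acthom_mul.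
Proof. by move=> f; apply/acthom_eqP. Qed.

HB.instance Definition _ := isMonoid.Build {acthom A -> A}
  acthom_mulA acthom_mul1 acthom_mulr1.

End EndMonoid.

Section Properties.
Variables (S : monoidType) (A : actType S).

Definition quasi_injective : Prop :=
  forall (B : actType S) (g f : {acthom B -> A}),
    injective g -> exists h : {acthom A -> A}, f =1 h \o g.

Definition act_ker (f : {acthom A -> A}) : set (A * A) :=
  [set x | f x.1 = f x.2].

Definition act_im (f : {acthom A -> A}) : set (A * A) :=
  (range f `*` range f) `|` diagonal.

(* Powers are taken in the monoid {acthom A -> A}: [f ^+ n] is the n-fold
   iterate of [f]. *)
Definition strongly_Hopfian : Prop :=
  forall f : {acthom A -> A}, exists2 n : nat, (0 < n)%N &
    forall m : nat, (n <= m)%N -> act_ker (f ^+ m) = act_ker (f ^+ n).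

Definition strongly_coHopfian : Prop :=
  forall f : {acthom A -> A}, exists2 n : nat, (0 < n)%N &
    forall m : nat, (n <= m)%N -> act_im (f ^+ m) = act_im (f ^+ n).

End Properties.

(* Main.v *)
From HB Require Import structures.
Require Import Defs.
From mathcomp Require Import all_boot boolp classical_sets functions.

(** In a quasi-injective act [A], a map [f : C -> A] factors as [f = h \o g]
through [g : C -> A], with [h] an endomorphism of [A], as soon as the kernel
of [g] is contained in that of [f]: such an [f] induces a map on the image of
[g], which quasi-injectivity extends to all of [A] ([factor_through_image]).

If the kernels of [f ^+ n] and [f ^+ n.+1] coincide, this gives an endomorphism
[h] with [f ^+ n = h * f ^+ n.+1], and commutativity turns it into
[f ^+ n = f ^+ n.+1 * h].  By iteration [f ^+ n = f ^+ (n + k) * h ^+ k] for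
all [k], so the image of [f ^+ n] is contained in that of every higher power of
[f]; the reverse inclusion is clear, and the images stabilize at [n]. *)

Set Implicit Arguments.
Unset Strict Implicit.
Unset Printing Implicit Defensive.

Import Algebra.
Local Open Scope group_scope.
Local Open Scope classical_set_scope.

Section Image.
Variables (S : monoidType) (C A : actType S) (g : {acthom C -> A}).

(** The image of [g], as a subact of [A]. *)
Definition image_act : Type := {y : A | range g y}.

Definition image_incl (y : image_act) : A := sval y.

Lemma image_incl_inj : injective image_incl.
Proof. by case=> [y gy] [z gz] yz; apply: eq_exist. Qed.

Fact image_act_closed (y : image_act) (s : S) : range g (act (sval y) s).
Proof. by case: y => y /= [c _ <-]; exists (act c s); rewrite ?act_homE. Qed.

Definition image_act_op (y : image_act) (s : S) : image_act :=
  exist _ (act (sval y) s) (image_act_closed y s).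

Fact image_act_nonempty : inhabited image_act.
Proof. by case: (@act_nonempty S C) => c; split; exists (g c); exists c. Qed.

Fact image_act1 (y : image_act) : image_act_op y 1 = y.
Proof. by apply: image_incl_inj; rewrite /image_incl /= act1. Qed.

Fact image_actM (y : image_act) (s t : S) :
  image_act_op y (s * t) = image_act_op (image_act_op y s) t.
Proof. by apply: image_incl_inj; rewrite /image_incl /= actM. Qed.

HB.instance Definition _ := isAct.Build S image_act
  image_act_nonempty image_act1 image_actM.

Fact image_incl_hom (y : image_act) (s : S) :
  image_incl (act y s) = act (image_incl y) s.
Proof. by []. Qed.

HB.instance Definition _ :=
  isActHom.Build S image_act A image_incl image_incl_hom.

Definition image_preim (y : image_act) : C := sval (cid2 (svalP y)).

Lemma image_preimK (y : image_act) : g (image_preim y) = sval y.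
Proof. by rewrite /image_preim; case: (cid2 _). Qed.

Variable (f : {acthom C -> A}).
Hypothesis ker_gf : forall c d, g c = g d -> f c = f d.

(** The map [g c |-> f c] on the image of [g]; it does not depend on the
chosen preimages because the kernel of [g] is contained in that of [f]. *)
Definition image_lift (y : image_act) : A := f (image_preim y).

Fact image_lift_hom (y : image_act) (s : S) :
  image_lift (act y s) = act (image_lift y) s.
Proof.
rewrite /image_lift -act_homE; apply: ker_gf.
by rewrite act_homE !image_preimK.
Qed.

Lemma factor_through_image :
  quasi_injective A -> exists h : {acthom A -> A}, f =1 h \o g.
Proof.
pose lift : {acthom image_act -> A} := HB.pack image_lift
  (isActHom.Build S image_act A image_lift image_lift_hom).
move=> /(_ _ image_incl lift image_incl_inj)[h hE].
exists h => c.
have gc : range g (g c) by exists c.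
have /= <- := hE (exist _ (g c) gc).
by apply: ker_gf; rewrite image_preimK.
Qed.

End Image.

Section Images.
Variables (S : monoidType) (A : actType S).

Lemma range_acthomM (f g : {acthom A -> A}) : range (f * g) `<=` range f.
Proof. by move=> _ [a _ <-]; exists (g a). Qed.

Lemma act_im_eq (f g u v : {acthom A -> A}) :
  f = g * u -> g = f * v -> act_im f = act_im g.
Proof.
move=> fE gE; rewrite /act_im; suff -> : range f = range g by [].
by apply/seteqP; split; [rewrite fE | rewrite gE]; apply: range_acthomM.
Qed.

End Images.

Theorem theorem4p6 (S : monoidType) (A : actType S)
  (A_quasi_injective : quasi_injective A)
  (A_strongly_Hopfian : strongly_Hopfian A)
  (End_commutative : commutative (fun f g : {acthom A -> A} => (f * g)%g)) :
  strongly_coHopfian A.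
Proof.
move=> f; have [n n_gt0 kerE] := A_strongly_Hopfian f.
exists n => //.
have ker_sub a b : (f ^+ n.+1) a = (f ^+ n.+1) b -> (f ^+ n) a = (f ^+ n) b.
  move=> fab; have := kerE n.+1 (leqnSn n).
  by move=> /seteqP[/(_ (a, b)) + _]; apply.
have [h hE] := factor_through_image ker_sub A_quasi_injective.
have fnE : f ^+ n = f ^+ n.+1 * h.
  by rewrite End_commutative; apply/acthom_eqP.
have fnkE k : f ^+ n = f ^+ (n + k) * h ^+ k.
  elim: k => [|k IHk]; first by rewrite addn0 expg0 mulg1.
  (* multiply [fnE] on the left by [f ^+ k] and substitute in [IHk] *)
  rewrite {1}IHk addnC expgnDr fnE mulgA -expgnDr -mulgA -expgS.
  by rewrite addnS addnC addnS.
move=> m /subnKC <-.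
by apply: (act_im_eq (u := f ^+ (m - n))); [rewrite expgnDr | exact: fnkE].
Qed.
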